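(* Let $N$ be an $\mathbb{N}_0$-valued random variable whose probability mass function belongs to the Panjer $(a,b)$ class, and let $(X_i)_{i\ge 1}$ be an iid sequence of $\mathbb{N}_0$-valued random variables, independent of $N$. Let $S_N=\sum_{i=1}^N X_i$, let $C_0:=aP(X_1=0)$, and for $k,\ell\in\mathbb{N}_0$ let $m_k(\ell):=E[N^k;S_N=\ell]$. Then for every $k\in\mathbb{N}_0$, $$m_k(0)=E\big[N^k\,P(X_1=0)^N\big],$$ and for every $k\in\mathbb{N}_0$ and every integer $\ell\ge 1$, $$m_k(\ell)=\frac{1}{1-C_0}\Big\{C_0\sum_{j=0}^{k-1}\binom{k}{j}m_j(\ell)+\sum_{j=1}^{\ell}\Big(a+\frac{bj}{\ell}\Big)P(X_1=j)\sum_{i=0}^{k}\binom{k}{i}m_i(\ell-j)\Big\},$$ where $m_0(\ell)=P(S_N=\ell)$.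
   Context: $\mathbb{N}=\{1,2,\ldots\}$ and $\mathbb{N}_0=\{0,1,2,\ldots\}$. The probability mass function $q_n=P(N=n)$ belongs to the Panjer $(a,b)$ class if $q_n=\big(a+\frac{b}{n}\big)q_{n-1}$ for all $n\in\mathbb{N}$, where $a,b$ are real numbers with $a+b\ge 0$ and $a<1$. For a random variable $Y$ and an event $A$, $E[Y;A]:=E[Y\,I_A]$, where $I_A$ is the indicator of $A$. The empty sum is $0$ (so $S_N=0$ when $N=0$), and $0^0=1$ by convention. *)

(* Defs.v *)
From HB Require Import structures.
From mathcomp Require Import all_boot all_order all_algebra finmap.
From mathcomp Require Import all_classical all_reals all_analysis.

Set Implicit Arguments.
Unset Strict Implicit.
Unset Printing Implicit Defensive.

Import Order.TTheory GRing.Theory Num.Theory.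
Import numFieldNormedType.Exports.

Local Open Scope classical_set_scope.
Local Open Scope ring_scope.

Section definitions.
Context {d : measure_display} {T : measurableType d} {R : realType}.
Context (P : probability T R).

Definition nat_pmf (Y : {RV P >-> nat}) (n : nat) : R :=
  fine (P (Y @^-1` [set n])).

(* The index is shifted by one: n.+1 ranges over the positive integers. *)
Definition panjer (a b : R) (q : nat -> R) : Prop :=
  [/\ 0 <= a + b, a < 1 &
      forall n : nat, q n.+1 = (a + b / n.+1%:R) * q n].

Definition independent_seq {d'} {T' : measurableType d'}
    (X : nat -> {RV P >-> T'}) : Prop :=
  forall (J : {fset nat}) (B : nat -> set T'),
    (forall i, i \in J -> measurable (B i)) ->
    P (\bigcap_(i in [set` J]) (X i @^-1` B i)) =
      (\prod_(i <- J) P (X i @^-1` B i))%E.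

Definition identically_distributed {d'} {T' : measurableType d'}
    (X : nat -> {RV P >-> T'}) : Prop :=
  forall (i j : nat) (B : set T'), measurable B ->
    distribution P (X i) B = distribution P (X j) B.

Definition iid {d'} {T' : measurableType d'}
    (X : nat -> {RV P >-> T'}) : Prop :=
  independent_seq X /\ identically_distributed X.

Definition sigma_seq {d'} {T' : measurableType d'}
    (X : nat -> {RV P >-> T'}) : set (set T) :=
  <<s \bigcup_i preimage_set_system setT (X i) measurable >>.

Definition independent_of_seq {d1 d2} {T1 : measurableType d1}
    {T2 : measurableType d2}
    (Y : {RV P >-> T1}) (X : nat -> {RV P >-> T2}) : Prop :=
  forall (B : set T1) (A : set T), measurable B -> sigma_seq X A ->
    P (Y @^-1` B `&` A) = (P (Y @^-1` B) * P A)%E.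

(* Sequences are indexed from 0: [X i] is the (i+1)-st summand. *)
Definition random_sum (N : {RV P >-> nat}) (X : nat -> {RV P >-> nat})
    (t : T) : nat :=
  (\sum_(i < N t) X i t)%N.

(* E[Y; A] *)
Definition expectation_on (Y : T -> R) (A : set T) : \bar R :=
  ('E_P[(Y \* \1_A)%R])%E.

(* Extended-real valued, so that no integrability is presupposed. *)
Definition sum_moment (N : {RV P >-> nat}) (X : nat -> {RV P >-> nat})
    (k l : nat) : \bar R :=
  expectation_on (fun t => (N t)%:R ^+ k) (random_sum N X @^-1` [set l]).

End definitions.

(* Main.v *)
Require Import Defs.
From HB Require Import structures.
From mathcomp Require Import all_boot all_order all_algebra finmap.
From mathcomp Require Import all_classical all_reals all_analysis.
From mathcomp Require Import measurable_realfun ring.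
Import Order.TTheory GRing.Theory Num.Theory.
Import numFieldNormedType.Exports.
Local Open Scope classical_set_scope.
Local Open Scope ring_scope.

(** Write q_n for P(N = n), p_j for P(X_1 = j), and g_n(l) for
    P(X_1 + ... + X_n = l), the n-fold convolution power of [p].  Splitting
    over the values of [N] and using independence,

      m_k(l) = sum_n n^k q_n g_n(l).

    Exchangeability of the summands says that, given X_1 + ... + X_n = l, each
    summand has conditional mean l / n.  In terms of convolution powers this is
    the identity l g_n(l) = n sum_j j p_j g_(n-1)(l - j), which is what the
    derivative of an n-th power of a polynomial says about its coefficients
    ([conv_pow_size_bias]).  It turns the b / n of the Panjer recursion into a
    weight that no longer involves n ([conv_pow_panjer]):

      (a + b / n) g_n(l) = sum_(j <= l) (a + b j / l) p_j g_(n-1)(l - j).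

    Hence n^k q_n g_n(l) = n^k q_(n-1) sum_j (a + b j / l) p_j g_(n-1)(l - j);
    expanding n^k = ((n - 1) + 1)^k by the binomial theorem and summing over
    n >= 1 gives m_k(l) as a combination of the m_i(l - j), [0 <= j <= l] and
    [i <= k].  Its only term in m_k(l) itself is the one with j = 0 and i = k,
    which has coefficient a p_0 = C_0 <> 1, so one can solve for m_k(l).

    The coefficients a + b j / l may be negative, so this rearrangement needs
    the moments of N to be finite.  That follows from the Panjer recursion for
    binomial moments: F_k(M) := sum_(n < M) binom(n, k) q_n satisfies
    (k+1) F_(k+1)(M+1) = a (k+1) F_(k+1)(M) + (a (k+1) + b) F_k(M), and since
    a < 1 a bound on F_k yields one on F_(k+1) ([panjer_binomial_bounded]). *)

(** * Convolution powers of a sequence *)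

Fixpoint conv_pow {R : pzRingType} (p : nat -> R) (n l : nat) : R :=
  if n is n'.+1 then \sum_(j < l.+1) p j * conv_pow p n' (l - j)
  else (l == 0%N)%:R.

Lemma conv_pow0 (R : pzRingType) (p : nat -> R) (n : nat) :
  conv_pow p n 0 = p 0%N ^+ n.
Proof. by elim: n => //= n IHn; rewrite big_ord1 subn0 IHn exprS. Qed.

(** Computing up to degree [L] only needs the polynomial truncation of [p], so
    the theory of polynomials replaces that of formal power series. *)
Lemma conv_pow_coef (R : nzRingType) (p : nat -> R) (L n l : nat) :
  (l <= L)%N -> conv_pow p n l = ((\poly_(i < L.+1) p i) ^+ n)`_l.
Proof.
elim: n l => [|n IHn] l lL /=; first by rewrite expr0 coef1.
rewrite exprS coefM; apply: eq_bigr => -[j /= jl] _.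
rewrite coef_poly ltnS (leq_trans _ lL) // IHn //.
exact: leq_trans (leq_subr _ _) lL.
Qed.

(** Compare coefficients in (s^(n+1))' = (n+1) s' s^n, where [s] is a truncation
    of the generating series of [p].  Probabilistically: given that n+1 iid
    variables sum to [l], each of them has mean l / (n+1). *)
Lemma conv_pow_size_bias (R : comNzRingType) (p : nat -> R) (n l : nat) :
  l%:R * conv_pow p n.+1 l =
  n.+1%:R * \sum_(j < l.+1) j%:R * p j * conv_pow p n (l - j).
Proof.
case: l => [|l]; first by rewrite big_ord1 !mul0r mulr0.
rewrite (@conv_pow_coef _ _ l.+1) //; set s := poly _ _.
rewrite !mulr_natl -coef_deriv deriv_exp /= coefMn coefM.
rewrite [in RHS]big_ord_recl !mul0r add0r; congr (_ *+ _).
apply: eq_bigr => -[j /= jl] _.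
rewrite /bump /= add1n subSS coef_deriv coef_poly ltnS jl.
by rewrite (@conv_pow_coef _ _ l.+1) ?mulr_natl // leqW ?leq_subr.
Qed.

(** The point of this form is that the coefficients on the right do not depend
    on [n], so that the sum over [n] can be taken inside. *)
Lemma conv_pow_panjer (R : numFieldType) (p : nat -> R) (a b : R) (n l : nat) :
  (0 < l)%N ->
  (a + b / n.+1%:R) * conv_pow p n.+1 l =
  \sum_(j < l.+1) (a + b * j%:R / l%:R) * p j * conv_pow p n (l - j).
Proof.
move=> l_gt0.
have l0 : l%:R != 0 :> R by rewrite pnatr_eq0 -lt0n.
have n0 : n.+1%:R != 0 :> R by rewrite pnatr_eq0.
have -> : (a + b / n.+1%:R) * conv_pow p n.+1 l =
  a * conv_pow p n.+1 l + b / l%:R / n.+1%:R * (l%:R * conv_pow p n.+1 l).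
  by field; rewrite l0 addrC natr1 n0.
rewrite conv_pow_size_bias mulrA divfK // /= !mulr_sumr -big_split /=.
by apply: eq_bigr => j _; ring.
Qed.

(** * Finiteness of the moments of a Panjer distribution *)

Lemma mul_natr_bin (R : pzRingType) (n k : nat) :
  n%:R * 'C(n, k)%:R = k.+1%:R * 'C(n, k.+1)%:R + k%:R * 'C(n, k)%:R :> R.
Proof.
rewrite -!natrM -natrD mul_bin_left -mulnDl.
by have [/subnK->//|nk] := leqP k n; rewrite bin_small // !muln0.
Qed.

Section PanjerMoments.
Variables (R : realType) (a b : R) (q : nat -> R).
Hypothesis q_ge0 : forall n, 0 <= q n.
Hypothesis a_lt1 : a < 1.
Hypothesis q_rec : forall n, q n.+1 = (a + b / n.+1%:R) * q n.

(** Binomial moments are the right ones here: the absorption identity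
    (k+1) binom(n+1, k+1) = (n+1) binom(n, k) cancels the denominator of the
    recursion, leaving an affine factor a (n+1) + b that raises the order of the
    moment by one with coefficient exactly [a]. *)
Lemma panjer_binomial_rec (k M : nat) :
  k.+1%:R * (\sum_(n < M.+1) 'C(n, k.+1)%:R * q n) =
  a * (k.+1%:R * \sum_(n < M) 'C(n, k.+1)%:R * q n) +
  (a * k.+1%:R + b) * \sum_(n < M) 'C(n, k)%:R * q n.
Proof.
elim: M => [|M IHM].
  by rewrite big_ord1 !big_ord0 bin0n !mul0r !mulr0 addr0.
rewrite big_ord_recr mulrDr [in LHS]IHM ![in RHS]big_ord_recr /=.
have M0 : M.+1%:R != 0 :> R by rewrite pnatr_eq0.
have -> : k.+1%:R * ('C(M.+1, k.+1)%:R * q M.+1) =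
    (a * (M%:R * 'C(M, k)%:R) + (a + b) * 'C(M, k)%:R) * q M.
  rewrite mulrA -natrM -mul_bin_diag /= natrM q_rec -natr1; field.
  by rewrite natr1.
by rewrite mul_natr_bin -!natr1; ring.
Qed.

Hypothesis q_bounded : exists B : R, forall M, \sum_(n < M) q n <= B.

(** The recursion is a contraction, as [a < 1]; a negative [a] only helps, which
    is why the rate is [max a 0]. *)
Lemma panjer_binomial_bounded (k : nat) :
  exists B : R, forall M, \sum_(n < M) 'C(n, k)%:R * q n <= B.
Proof.
elim: k => [|k [B BP]].
  have [B BP] := q_bounded; exists B => M.
  rewrite (eq_bigr (fun n : 'I_M => q n)) => [|n _]; first exact: BP.
  by rewrite bin0 mul1r.
pose c := `|a * k.+1%:R + b| / k.+1%:R.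
have B0 : 0 <= B by have := BP 0%N; rewrite big_ord0.
have c0 : 0 <= c by rewrite divr_ge0.
pose r := Num.max a 0.
have r1 : 0 < 1 - r by rewrite subr_gt0 /r gt_max a_lt1 ltr01.
have k0 : 0 < k.+1%:R :> R by [].
(* This is the fixed point of F |-> r F + c B. *)
exists (c * B / (1 - r)); elim=> [|M IHM].
  by rewrite big_ord0 divr_ge0 ?mulr_ge0 // ltW.
have F0 : 0 <= \sum_(n < M) 'C(n, k.+1)%:R * q n.
  by apply: sumr_ge0 => n _; rewrite mulr_ge0.
have G0 : 0 <= \sum_(n < M) 'C(n, k)%:R * q n.
  by apply: sumr_ge0 => n _; rewrite mulr_ge0.
rewrite -(ler_pM2l k0) panjer_binomial_rec.
have -> : k.+1%:R * (c * B / (1 - r)) =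
    r * (k.+1%:R * (c * B / (1 - r))) + `|a * k.+1%:R + b| * B.
  rewrite /c; move: k.+1%:R k0 => K K0.
  by field; rewrite (gt_eqF K0) (gt_eqF r1).
apply: lerD.
  apply: (@le_trans _ _ (r * (k.+1%:R * \sum_(n < M) 'C(n, k.+1)%:R * q n))).
    by rewrite ler_wpM2r ?mulr_ge0 // le_max lexx.
  by rewrite ler_wpM2l ?le_max ?lexx ?orbT // ler_wpM2l.
apply: (le_trans (ler_wpM2r G0 (ler_norm _))).
by rewrite ler_wpM2l.
Qed.

(** Interpolates between binomial moments ([k = 0]) and power moments ([j = 0]):
    each factor [n] is absorbed by n binom(n, j) =
    (j+1) binom(n, j+1) + j binom(n, j). *)
Lemma panjer_mixed_bounded (k j : nat) :
  exists B : R, forall M, \sum_(n < M) n%:R ^+ k * 'C(n, j)%:R * q n <= B.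
Proof.
elim: k j => [|k IHk] j.
  have [B BP] := panjer_binomial_bounded j; exists B => M.
  by under eq_bigr do rewrite expr0 mul1r.
have [B BP] := IHk j.+1; have [B' BP'] := IHk j.
exists (j.+1%:R * B + j%:R * B') => M.
under eq_bigr do rewrite exprSr -[_ * _ * 'C(_, _)%:R]mulrA mul_natr_bin.
rewrite (eq_bigr (fun n : 'I_M =>
  j.+1%:R * (n%:R ^+ k * 'C(n, j.+1)%:R * q n) +
  j%:R * (n%:R ^+ k * 'C(n, j)%:R * q n))); last by move=> n _; ring.
rewrite big_split /= -!mulr_sumr.
by apply: lerD; apply: ler_wpM2l => //; [exact: BP | exact: BP'].
Qed.

Lemma panjer_moment_bounded (k : nat) :
  exists B : R, forall M, \sum_(n < M) n%:R ^+ k * q n <= B.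
Proof.
have [B BP] := panjer_mixed_bounded k 0; exists B => M.
by have := BP M; under eq_bigr do rewrite bin0 mulr1.
Qed.

(** * The recursion for truncated moments *)

Variable p : nat -> R.

Definition partial_moment (k l M : nat) : R :=
  \sum_(n < M) n%:R ^+ k * (q n * conv_pow p n l).

(** The term [n = 0] vanishes because [0 < l]; every other one is transformed by
    the Panjer recursion and [conv_pow_panjer], and the power of [n+1] is then
    expanded.  Working with truncated sums keeps this an identity between finite
    sums, at the cost of a shift in [M] that is invisible in the limit. *)
Lemma partial_moment_rec (k l M : nat) : (0 < l)%N ->
  partial_moment k l M.+1 =
  \sum_(j < l.+1) (a + b * j%:R / l%:R) * p j *
    \sum_(i < k.+1) 'C(k, i)%:R * partial_moment i (l - j) M.
Proof.
move=> l_gt0; rewrite /partial_moment big_ord_recl /= (gtn_eqF l_gt0) !mulr0 add0r.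
under [RHS]eq_bigr do under eq_bigr do rewrite mulr_sumr.
under [RHS]eq_bigr do rewrite exchange_big mulr_sumr /=.
rewrite [RHS]exchange_big /=; apply: eq_bigr => n _.
rewrite /bump leq0n add1n.
transitivity (n.+1%:R ^+ k * q n * ((a + b / n.+1%:R) * conv_pow p n.+1 l)).
  by rewrite q_rec /=; ring.
rewrite conv_pow_panjer // mulr_sumr; apply: eq_bigr => j _.
have -> : n.+1%:R ^+ k = \sum_(i < k.+1) 'C(k, i)%:R * n%:R ^+ i :> R.
  rewrite -natr1 addrC exprDn; apply: eq_bigr => i _.
  by rewrite expr1n mul1r mulr_natl.
by rewrite !mulr_suml mulr_sumr; apply: eq_bigr => i _; ring.
Qed.

Lemma partial_moment_limit_rec (mu : nat -> nat -> R) (k l : nat) :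
  (0 < l)%N -> (forall k l, partial_moment k l @ \oo --> mu k l) ->
  mu k l = \sum_(j < l.+1) (a + b * j%:R / l%:R) * p j *
    \sum_(i < k.+1) 'C(k, i)%:R * mu i (l - j)%N.
Proof.
move=> l_gt0 mu_cvg.
have := mu_cvg k l; rewrite -cvg_shiftS => mu_shift.
apply: (cvg_unique _ mu_shift) => //.
rewrite (funext (fun M => partial_moment_rec k l M l_gt0)).
apply: cvg_big => [|j _]; first exact: add_continuous.
apply: cvgMr; apply: cvg_big => [|i _]; first exact: add_continuous.
by apply: cvgMr; exact: mu_cvg.
Qed.
End PanjerMoments.
Arguments partial_moment {R}.

(** * The law of the random sum *)

Section RandomSums.
Context {d : measure_display} {T : measurableType d} {R : realType}.
Context {P : probability T R}.
Implicit Types (Y N : {RV P >-> nat}) (X : nat -> {RV P >-> nat}).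

Definition fixed_sum X (n : nat) (t : T) : nat := (\sum_(i < n) X i t)%N.

Lemma measurable_preimage_nat Y (B : set nat) : measurable (Y @^-1` B).
Proof. exact: measurable_funPTI. Qed.

Lemma nat_pmfE Y (n : nat) : P (Y @^-1` [set n]) = (nat_pmf Y n)%:E.
Proof.
by rewrite /nat_pmf fineK // fin_num_measure //; exact: measurable_preimage_nat.
Qed.

Lemma nat_pmf_ge0 Y (n : nat) : 0 <= nat_pmf Y n.
Proof. by rewrite /nat_pmf fine_ge0. Qed.

Lemma fixed_sumS_preimage X (n l : nat) :
  fixed_sum X n.+1 @^-1` [set l] =
  \bigcup_(j < l.+1) (X n @^-1` [set j] `&` fixed_sum X n @^-1` [set (l - j)%N]).
Proof.
apply/seteqP; split => [t /= <-|t [j /= jl [Xj sum_t]]].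
  exists (X n t); rewrite /= /fixed_sum big_ord_recr /=.
    by rewrite ltnS leq_addl.
  by rewrite addnK.
by rewrite /fixed_sum big_ord_recr /= -/(fixed_sum X n t) sum_t Xj subnK.
Qed.

(** Independence of [N] from the sequence is stated on the sigma-algebra that the
    sequence generates, so its application to partial sums needs this. *)
Lemma sigma_seq_fixed_sum X (n l : nat) :
  sigma_seq X (fixed_sum X n @^-1` [set l]).
Proof.
pose U : set (set T) := \bigcup_i preimage_set_system [set: T] (X i) measurable.
elim: n l => [|n IHn] l.
  have [s0 sD sU] : sigma_algebra setT <<s U >> by exact: smallest_sigma_algebra.
  have sT : <<s U >> setT by have := sD _ s0; rewrite setD0.
  have [l0|l0] := eqVneq l 0%N.
    rewrite (_ : _ @^-1` _ = setT) //; apply/seteqP; split => t //= _.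
    by rewrite /fixed_sum big_ord0 l0.
  rewrite (_ : _ @^-1` _ = set0) //; apply/seteqP; split => t //=.
  by rewrite /fixed_sum big_ord0 => l0'; rewrite -l0' eqxx in l0.
rewrite fixed_sumS_preimage.
pose M : measurableType _ := g_sigma_algebraType U.
apply: (@bigcup_measurable _ M) => j _.
apply: (@measurableI _ M); last exact: IHn.
apply: sub_sigma_algebra; exists n => //.
by exists [set j] => //; rewrite setTI.
Qed.

Lemma measurable_fixed_sum X (n l : nat) :
  measurable (fixed_sum X n @^-1` [set l]).
Proof.
suff sub : sigma_seq X `<=` measurable by apply: sub; exact: sigma_seq_fixed_sum.
apply: smallest_sub; first exact: sigma_algebra_measurable.
by move=> A [i _ [B _ <-]]; rewrite setTI; exact: measurable_preimage_nat.
Qed.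

(** For [J] empty this is the law of the sum of [n] terms; the induction on [n]
    needs the events on later terms, because the event [X n = j] is absorbed
    into them when the last summand is split off. *)
Lemma fixed_sum_joint_law X (n l : nat) (J : {fset nat}) (B : nat -> set nat) :
  iid X -> (forall i, i \in J -> (n <= i)%N) ->
  P (fixed_sum X n @^-1` [set l] `&` \bigcap_(i in [set` J]) (X i @^-1` B i)) =
  (conv_pow (nat_pmf (X 0%N)) n l *
   \prod_(i <- J) fine (P (X i @^-1` B i)))%:E.
Proof.
move=> [X_ind X_id]; elim: n l J B => [|n IHn] l J B Jn.
  have [->|l0] := eqVneq l 0%N.
    rewrite mul1r (_ : _ @^-1` _ = setT); last first.
      by apply/seteqP; split => t //= _; rewrite /fixed_sum big_ord0.
    rewrite setTI X_ind // -prodEFin; apply: eq_bigr => i _.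
    by rewrite fineK // fin_num_measure //; exact: measurable_preimage_nat.
  rewrite /= (negbTE l0) mul0r (_ : _ @^-1` _ = set0) ?set0I ?measure0 //.
  apply/seteqP; split => t //=.
  by rewrite /fixed_sum big_ord0 => l0'; rewrite -l0' eqxx in l0.
have nJ : n \notin J by apply/negP => /Jn; rewrite ltnn.
(* The induction hypothesis is applied to the index set J with n added. *)
pose B' j i := if i == n then [set j] else B i.
pose C j := fixed_sum X n @^-1` [set (l - j)%N] `&`
  \bigcap_(i in [set` (n |` J)%fset]) (X i @^-1` B' j i).
have CE j : C j = (X n @^-1` [set j] `&` fixed_sum X n @^-1` [set (l - j)%N])
   `&` \bigcap_(i in [set` J]) (X i @^-1` B i).
  rewrite /C -setIA [in RHS]setICA; congr (_ `&` _).
  apply/seteqP; split => t.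
    move=> Ct; split.
      by have := Ct n; rewrite /B' eqxx; apply; rewrite /= fset1U1.
    move=> i /= iJ; have := Ct i; rewrite /B'.
    case: eqVneq => [ein|_]; first by rewrite -ein iJ in nJ.
    by apply; rewrite /= fset1Ur.
  move=> [Xn Jt] i /=; rewrite in_fset1U /B'; case: eqVneq => [-> _ //|_ /=].
  exact: Jt.
have -> : fixed_sum X n.+1 @^-1` [set l] `&`
    \bigcap_(i in [set` J]) (X i @^-1` B i) = \big[setU/set0]_(j < l.+1) C j.
  rewrite fixed_sumS_preimage setI_bigcupl -bigcup_mkord.
  by apply: eq_bigcupr => j _; rewrite CE.
have mC j : measurable (C j).
  apply: measurableI; first exact: measurable_fixed_sum.
  apply: fin_bigcap_measurable => // i _; exact: measurable_preimage_nat.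
have tC : trivIset setT C.
  apply/trivIsetP => i j _ _ ij; rewrite !CE; apply/seteqP; split => t //=.
  by move=> [[[-> _] _] [[ji _] _]]; rewrite ji eqxx in ij.
rewrite measure_bigsetU // /= mulr_suml -sumEFin; apply: eq_bigr => -[j /= jl] _.
rewrite /C IHn; last first.
  move=> i; rewrite in_fset1U => /orP[/eqP-> //|/Jn]; exact: ltnW.
rewrite big_fsetU1 //= /B' eqxx mulrCA -mulrA; congr (_ * (_ * _))%:E.
  by rewrite /nat_pmf; congr fine; exact: X_id.
apply: eq_big_seq => i iJ; case: eqVneq => // ein.
by rewrite -ein iJ in nJ.
Qed.

Lemma fixed_sum_law X (n l : nat) : iid X ->
  P (fixed_sum X n @^-1` [set l]) = (conv_pow (nat_pmf (X 0%N)) n l)%:E.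
Proof.
move=> X_iid; have := @fixed_sum_joint_law X n l fset0 (fun=> setT) X_iid.
by rewrite big_seq_fset0 mulr1 set_fset0 bigcap_set0 setIT; apply.
Qed.

Lemma conv_pow_pmf_ge0 X (n l : nat) : iid X ->
  0 <= conv_pow (nat_pmf (X 0%N)) n l.
Proof. by move=> X_iid; rewrite -lee_fin -fixed_sum_law. Qed.

Lemma conv_pow_pmf_le1 X (n l : nat) : iid X ->
  conv_pow (nat_pmf (X 0%N)) n l <= 1.
Proof.
move=> X_iid; rewrite -lee_fin -fixed_sum_law //.
exact/probability_le1/measurable_fixed_sum.
Qed.

Lemma random_sum_cell N X (n l : nat) :
  N @^-1` [set n] `&` random_sum N X @^-1` [set l] =
  N @^-1` [set n] `&` fixed_sum X n @^-1` [set l].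
Proof. by apply/seteqP; split => t /= [<-]. Qed.

Lemma preimage_nat_partition N (A : set T) :
  A = \bigcup_n (N @^-1` [set n] `&` A).
Proof. by apply/seteqP; split => [t At|t [n _ []]//]; exists (N t). Qed.

Lemma measurable_random_sum N X (l : nat) :
  measurable (random_sum N X @^-1` [set l]).
Proof.
rewrite (preimage_nat_partition N (_ @^-1` _)); apply: bigcup_measurable => n _.
rewrite random_sum_cell; apply: measurableI; last exact: measurable_fixed_sum.
exact: measurable_preimage_nat.
Qed.

Lemma random_sum_joint_law N X (n l : nat) : iid X -> independent_of_seq N X ->
  P (N @^-1` [set n] `&` random_sum N X @^-1` [set l]) =
  (nat_pmf N n * conv_pow (nat_pmf (X 0%N)) n l)%:E.
Proof.
move=> X_iid NX; rewrite random_sum_cell NX //; last exact: sigma_seq_fixed_sum.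
by rewrite nat_pmfE fixed_sum_law // EFinM.
Qed.

Lemma nat_pmf_partial_sum_le1 N (M : nat) : \sum_(n < M) nat_pmf N n <= 1.
Proof.
pose F n := N @^-1` [set n].
have mF n : measurable (F n) by exact: measurable_preimage_nat.
have tF : trivIset setT F.
  apply/trivIsetP => i j _ _ ij; rewrite /F; apply/seteqP; split => t //=.
  by move=> [-> ji]; rewrite ji eqxx in ij.
have PF : P (\big[setU/set0]_(n < M) F n) = (\sum_(n < M) nat_pmf N n)%:E.
  rewrite measure_bigsetU // -sumEFin; apply: eq_bigr => n _; exact: nat_pmfE.
rewrite -lee_fin -PF; apply: probability_le1.
by apply: bigsetU_measurable => n _; exact: mF.
Qed.

(** Countable additivity of the integral over the values of [N]; as the integrand
    is nonnegative, it holds in the extended reals without integrability. *)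
Lemma expectation_on_series N (f : nat -> R) (A : set T) :
  measurable A -> (forall n, 0 <= f n) ->
  expectation_on P (fun t => f (N t)) A =
  (\sum_(0 <= n <oo) (f n)%:E * P (N @^-1` [set n] `&` A))%E.
Proof.
move=> mA f0; rewrite /expectation_on unlock.
have mN n : measurable (N @^-1` [set n]) by exact: measurable_preimage_nat.
have NT : [set: T] = \bigcup_n (N @^-1` [set n]).
  by rewrite [LHS](preimage_nat_partition N); under eq_bigcupr do rewrite setIT.
rewrite [X in integral _ X _]NT ge0_integral_bigcup //=; first last.
- apply/trivIsetP => i j _ _ ij; apply/seteqP; split => t //=.
  by move=> [-> ji]; rewrite ji eqxx in ij.
- by move=> t _; rewrite lee_fin mulr_ge0.
- rewrite -NT; apply/measurable_EFinP; apply: measurable_funM.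
    by apply: measurableT_comp.
  exact: measurable_indic.
apply: eq_eseriesr => n _.
transitivity (\int[P]_(x in N @^-1` [set n]) ((f n)%:E * (\1_A x)%:E))%E.
  by apply: eq_integral => t; rewrite inE /= => <-; rewrite EFinM.
rewrite ge0_integralZl //; first last.
- by rewrite lee_fin; exact: f0.
- by apply/measurable_EFinP; exact: measurable_indic.
by rewrite integral_indic // setIC.
Qed.
End RandomSums.

(** * Moments as limits of truncated moments *)

Lemma nneseries_EFin (R : realType) (u : nat -> R) (s : R) :
  (fun M => \sum_(n < M) u n) @ \oo --> s ->
  (\sum_(0 <= n <oo) (u n)%:E)%E = s%:E.
Proof.
move=> us; apply/cvg_lim => //.
under eq_fun do rewrite sumEFin big_mkord.
apply: cvg_EFin => //; exact: nearW.
Qed.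

Lemma partial_moment_cvg (R : realType) (q p : nat -> R) (k l : nat) :
  (forall n, 0 <= q n) -> (forall n, 0 <= conv_pow p n l <= 1) ->
  (exists B : R, forall M, \sum_(n < M) n%:R ^+ k * q n <= B) ->
  cvgn (partial_moment q p k l).
Proof.
move=> q0 g01 [B BP]; apply: nondecreasing_is_cvgn.
  apply/nondecreasing_seqP => M; rewrite /partial_moment big_ord_recr /= lerDl.
  by have /andP[g0 _] := g01 M; rewrite !mulr_ge0.
exists B => _ [M _ <-]; apply: le_trans (BP M).
apply: ler_sum => n _; rewrite ler_wpM2l //.
by have /andP[_ g1] := g01 n; rewrite ler_piMr.
Qed.

Lemma sum_moment_series (d : measure_display) (T : measurableType d)
    (R : realType) (P : probability T R) (N : {RV P >-> nat})
    (X : nat -> {RV P >-> nat}) (k l : nat) :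
  iid X -> independent_of_seq N X ->
  sum_moment N X k l =
  (\sum_(0 <= n <oo)
    (n%:R ^+ k * (nat_pmf N n * conv_pow (nat_pmf (X 0%N)) n l))%:E)%E.
Proof.
move=> X_iid NX; rewrite /sum_moment.
rewrite (@expectation_on_series _ _ _ _ N (fun n => n%:R ^+ k)) //; last first.
  exact: measurable_random_sum.
by apply: eq_eseriesr => n _; rewrite random_sum_joint_law // EFinM.
Qed.

(** All the moments are finite, so the recursion can be proved among reals. *)
Lemma sum_moment_lim (d : measure_display) (T : measurableType d)
    (R : realType) (P : probability T R) (N : {RV P >-> nat})
    (X : nat -> {RV P >-> nat}) (a b : R) :
  panjer a b (nat_pmf N) -> iid X -> independent_of_seq N X ->
  exists mu : nat -> nat -> R,
    (forall k l, sum_moment N X k l = (mu k l)%:E) /\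
    (forall k l, partial_moment (nat_pmf N) (nat_pmf (X 0%N)) k l @ \oo
       --> mu k l).
Proof.
move=> [_ a1 q_rec] X_iid NX.
pose mu k l := limn (partial_moment (nat_pmf N) (nat_pmf (X 0%N)) k l).
have mu_cvg k l : partial_moment (nat_pmf N) (nat_pmf (X 0%N)) k l @ \oo
    --> mu k l.
  apply: partial_moment_cvg; first by move=> n; exact: nat_pmf_ge0.
    by move=> n; rewrite conv_pow_pmf_ge0 ?conv_pow_pmf_le1.
  apply: (@panjer_moment_bounded _ a b) => //; first by move=> n; exact: nat_pmf_ge0.
  by exists 1 => M; exact: nat_pmf_partial_sum_le1.
exists mu; split=> // k l; rewrite sum_moment_series //.
exact/nneseries_EFin/mu_cvg.
Qed.

(** Solves for the diagonal term j = 0, i = k of the sum, whose coefficient is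
    [a * p 0]. *)
Lemma moment_rec_solve (R : realFieldType) (a b : R) (p : nat -> R)
    (mu : nat -> nat -> R) (k l : nat) :
  a * p 0%N != 1 ->
  mu k l = \sum_(j < l.+1) (a + b * j%:R / l%:R) * p j *
    \sum_(i < k.+1) 'C(k, i)%:R * mu i (l - j)%N ->
  mu k l = 1 / (1 - a * p 0%N) *
    (a * p 0%N * (\sum_(0 <= j < k) 'C(k, j)%:R * mu j l) +
     \sum_(1 <= j < l.+1) (a + b * j%:R / l%:R) * p j *
       \sum_(0 <= i < k.+1) 'C(k, i)%:R * mu i (l - j)%N).
Proof.
move=> C01; have C0' : 1 - a * p 0%N != 0 by rewrite subr_eq0 eq_sym.
rewrite -(big_mkord xpredT (fun j => (a + b * j%:R / l%:R) * p j *
  \sum_(i < k.+1) 'C(k, i)%:R * mu i (l - j)%N)).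
rewrite big_ltn // mulr0 mul0r addr0 subn0 big_ord_recr /= binn => E.
under [X in _ * (_ + X)]eq_bigr do rewrite big_mkord.
rewrite big_mkord -[LHS](mulKf C0') div1r; congr (_ * _).
by rewrite mulrBl mul1r {1}E; ring.
Qed.

Theorem theorem2p1 (d : measure_display) (T : measurableType d) (R : realType)
    (P : probability T R) (N : {RV P >-> nat}) (X : nat -> {RV P >-> nat})
    (a b : R)
    (N_panjer : panjer a b (nat_pmf N))
    (X_iid : iid X)
    (NX_indep : independent_of_seq N X) :
  let p := nat_pmf (X 0%N) in
  let C0 := a * p 0%N in
  let m := sum_moment N X in
  [/\ forall k : nat,
        m k 0%N = ('E_P[fun t => ((N t)%:R ^+ k * p 0%N ^+ N t)%R])%E,
      forall k l : nat, (1 <= l)%N ->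
        m k l =
          (((1 / (1 - C0))%R)%:E *
             (C0%:E * (\sum_(0 <= j < k) ('C(k, j)%:R%R)%:E * m j l) +
              \sum_(1 <= j < l.+1)
                ((a + b * j%:R / l%:R)%R)%:E * (p j)%:E *
                (\sum_(0 <= i < k.+1) ('C(k, i)%:R%R)%:E * m i (l - j)%N)))%E &
      forall l : nat, m 0%N l = P (random_sum N X @^-1` [set l])].
Proof.
move=> p C0 m.
have [mu [mE mu_cvg]] := sum_moment_lim _ _ _ _ _ _ _ _ N_panjer X_iid NX_indep.
split=> [k|k l l_gt0|l].
- rewrite /m sum_moment_series //.
  transitivity (expectation_on P
    (fun t => (N t)%:R ^+ k * p 0%N ^+ N t) [set: T]); last first.
    by congr expectation; apply/funext => t /=; rewrite indicT mulr1.
  rewrite (@expectation_on_series _ _ _ _ N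
    (fun n => n%:R ^+ k * p 0%N ^+ n)) //; last first.
    by move=> n; rewrite mulr_ge0 // exprn_ge0 // nat_pmf_ge0.
  apply: eq_eseriesr => n _.
  by rewrite setIT nat_pmfE -EFinM conv_pow0 mulrAC mulrA.
- have [_ a1 q_rec] := N_panjer.
  (* For a > 0 this uses p 0 <= 1, for a <= 0 it uses 0 <= p 0. *)
  have C01 : a * p 0%N != 1.
    rewrite lt_eqF //; have p0 : 0 <= p 0%N := nat_pmf_ge0 _ _.
    have p1 : p 0%N <= 1.
      by rewrite -lee_fin -nat_pmfE probability_le1 //; exact: measurable_preimage_nat.
    have [a0|a0] := leP a 0.
      by apply: le_lt_trans ltr01; rewrite mulr_le0_ge0.
    by apply: le_lt_trans a1; rewrite ler_piMr // ltW.
  have mu_rec := partial_moment_limit_rec _ _ _ _ q_rec p mu k l l_gt0 mu_cvg.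
  rewrite /m mE (moment_rec_solve _ _ _ _ _ _ _ C01 mu_rec).
  under [in RHS]eq_bigr do rewrite mE -EFinM.
  rewrite sumEFin.
  under [X in (_ * (_ + X))%E]eq_bigr do
    (under eq_bigr do rewrite mE -EFinM; rewrite sumEFin -!EFinM).
  by rewrite sumEFin.
- rewrite /m /sum_moment /expectation_on unlock.
  rewrite (eq_integral (fun t => (\1_(random_sum N X @^-1` [set l]) t)%:E)).
    by rewrite integral_indic ?setIT //; exact: measurable_random_sum.
  by move=> t _; rewrite /= mul1r.
Qed.
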